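(* Let $S = R \cup B$ be a set of $2n$ points in general position (no three collinear) in the plane with $|R| = |B| = n$ (red points $R$, blue points $B$), such that $R$ and $B$ are linearly separable. Then $S$ has at least $\frac{2n^2+3n-8}{12}$ balanced $4$-holes.
   Context: A hole of $S$ is a simple polygon with vertices in $S$ and no point of $S$ in its interior (not necessarily convex); a $4$-hole has $4$ vertices and is balanced if it has exactly two red and two blue vertices. $R$ and $B$ are linearly separable if some line has all of $R$ strictly on one side and all of $B$ strictly on the other. *)

(* Defs.v *)
From mathcomp Require Import all_boot all_order all_algebra.
From mathcomp Require Import boolp reals.
Set Implicit Arguments. Unset Strict Implicit. Unset Printing Implicit Defensive.
Import Order.TTheory GRing.Theory Num.Theory.
Local Open Scope ring_scope.

Section Geom.
Variable R : realType.
Definition point := (R * R)%type.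

(* twice the signed area of triangle abc *)
Definition orient (a b c : point) : R :=
  (b.1 - a.1) * (c.2 - a.2) - (b.2 - a.2) * (c.1 - a.1).

Definition collinear (a b c : point) : Prop := orient a b c = 0.

Definition on_seg (p q x : point) : Prop :=
  exists t : R, 0 <= t <= 1 /\ x = (p.1 + t * (q.1 - p.1), p.2 + t * (q.2 - p.2)).

Definition segs_meet (p q p' q' : point) : Prop :=
  exists x, on_seg p q x /\ on_seg p' q' x.

Definition in_open_tri (a b c p : point) : bool :=
  ((0 < orient a b p) && (0 < orient b c p) && (0 < orient c a p)) ||
  ((orient a b p < 0) && (orient b c p < 0) && (orient c a p < 0)).

(* signed contribution of triangle abc to the winding number around p *)
Definition wtri (a b c p : point) : int :=
  if in_open_tri a b c p then sgz (orient a b c) else 0.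

(* winding number of the closed polygon a -> b -> c -> d -> a around p,
   computed by the fan decomposition from a (valid for p not on the
   boundary and not on the diagonal ac) *)
Definition winding4 (a b c d p : point) : int := wtri a b c p + wtri a c d p.

Definition simple_quad (a b c d : point) : Prop :=
  [/\ uniq [:: a; b; c; d],
      ~ segs_meet a b c d, ~ segs_meet b c d a &
      forall x, (on_seg a b x /\ on_seg b c x -> x = b) /\
                (on_seg b c x /\ on_seg c d x -> x = c) /\
                (on_seg c d x /\ on_seg d a x -> x = d) /\
                (on_seg d a x /\ on_seg a b x -> x = a)].

Definition interior_quad (a b c d p : point) : Prop :=
  ~ on_seg a b p /\ ~ on_seg b c p /\ ~ on_seg c d p /\ ~ on_seg d a p /\
  winding4 a b c d p <> 0.
End Geom.

Definition cidx (n : nat) : finType := ('I_n + 'I_n)%type.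

Definition is_red n (i : cidx n) : bool := if i is inl _ then true else false.

Section Holes.
Variables (R : realType) (n : nat) (pt : cidx n -> point R).

Definition general_position : Prop :=
  forall i j k : cidx n, i <> j -> j <> k -> i <> k -> ~ collinear (pt i) (pt j) (pt k).

Definition lin_separable : Prop :=
  exists a b c : R, (a != 0 \/ b != 0) /\
    (forall i, is_red i -> 0 < a * (pt i).1 + b * (pt i).2 + c) /\
    (forall i, ~~ is_red i -> a * (pt i).1 + b * (pt i).2 + c < 0).

Definition balanced_4hole (i0 i1 i2 i3 : cidx n) : Prop :=
  [/\ uniq [:: i0; i1; i2; i3],
      simple_quad (pt i0) (pt i1) (pt i2) (pt i3),
      (forall k, ~ interior_quad (pt i0) (pt i1) (pt i2) (pt i3) (pt k)) &
      count (@is_red n) [:: i0; i1; i2; i3] = 2%N].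

(* a 4-gon is identified with its set of edges (this identifies the 8
   vertex sequences obtained by rotation and reversal) *)
Definition quad_edges (i0 i1 i2 i3 : cidx n) : {set {set cidx n}} :=
  [set [set i0; i1]; [set i1; i2]; [set i2; i3]; [set i3; i0]].

Definition balanced_4holes : {set {set {set cidx n}}} :=
  [set E | [exists t : cidx n * cidx n * cidx n * cidx n,
     `[< balanced_4hole t.1.1.1 t.1.1.2 t.1.2 t.2 >] &&
     (E == quad_edges t.1.1.1 t.1.1.2 t.1.2 t.2)]].
End Holes.

(* Main.v *)
(* Let (r, b) be a red-blue pair. It is good if the open half-plane on the left
   of the ray from r to b contains points of both colours. At most n pairs have
   no blue point on their left, at most n have no red one, and the pair whose
   line crosses the separating line at the extreme point has neither; so there
   are at least (n-1)^2 good pairs.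

   For a good pair let x be the blue point following b around r on the left, and
   y the red point following r around b. The triangle r b x contains only red
   points, and r b y only blue ones. If one of these triangles contains exactly
   one point, that point and the triangle form a non-convex balanced 4-hole. If
   both are empty, consider all points k on the left for which r b k is empty:
   the last blue one around r and the last red one around b form a convex hole
   with r and b, since the point closest to the line r b among those inside it
   would come later. In each case (r, b) is the only red-blue pair of the four
   vertices with the other two on its left, so distinct pairs give distinct
   holes.

   There remain the pairs whose triangle r b x (or r b y) contains at least two
   points. For fixed r the cones r b x are disjoint, and every red point of such
   a cone is closer to the separating line than r, so at most n(n-1)/4 pairs are
   lost for each colour. Altogether there are at least
   (n-1)^2 - 2 floor(n(n-1)/4) holes. *)
Require Import Defs.
From mathcomp Require Import all_boot all_order all_algebra.
From mathcomp Require Import boolp reals.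
From mathcomp Require Import ring lra zify.
Import Order.TTheory GRing.Theory Num.Theory.
Set Implicit Arguments. Unset Strict Implicit. Unset Printing Implicit Defensive.
Local Open Scope ring_scope.

Section Orientation.
Variable R : realType.
Implicit Types (a b c p q x y z : point R) (u v t : R).

Lemma orient_rot a b c : orient b c a = orient a b c.
Proof. by rewrite /orient; ring. Qed.

Lemma orient_swapl a b c : orient b a c = - orient a b c.
Proof. by rewrite /orient; ring. Qed.

Lemma orient_swapr a b c : orient a c b = - orient a b c.
Proof. by rewrite /orient; ring. Qed.

Lemma orient_rev a b c : orient c b a = - orient a b c.
Proof. by rewrite /orient; ring. Qed.

Lemma orient_id12 a b : orient a a b = 0.
Proof. by rewrite /orient; ring. Qed.

Lemma orient_id13 a b : orient a b a = 0.
Proof. by rewrite /orient; ring. Qed.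

Lemma orient_id23 a b : orient a b b = 0.
Proof. by rewrite /orient; ring. Qed.

Lemma orient_neq0_uniq a b c : orient a b c != 0 -> uniq [:: a; b; c].
Proof.
move=> abc; rewrite /= !inE negb_or !andbT -andbA.
apply/and3P; split; apply: contraNneq abc => ->.
- by rewrite orient_id12.
- by rewrite orient_id13.
- by rewrite orient_id23.
Qed.

Lemma orient_split a b c z :
  orient a b z + orient b c z + orient c a z = orient a b c.
Proof. by rewrite /orient; ring. Qed.

Definition affine u v t p : R := u * p.1 + v * p.2 + t.

Lemma orient_affine p q z :
  orient p q z = affine (p.2 - q.2) (q.1 - p.1) (p.1 * q.2 - p.2 * q.1) z.
Proof. by rewrite /orient /affine; ring. Qed.

Lemma affine_barycentric u v t a b c z :
  orient a b c * affine u v t z =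
  orient b c z * affine u v t a + orient c a z * affine u v t b
  + orient a b z * affine u v t c.
Proof. by rewrite /orient /affine; ring. Qed.

Lemma affine_lt_cone u v t p q x z (f := affine u v t) :
  0 < orient p q x -> 0 < orient p q z -> 0 < orient x p z ->
  f q < f p -> f x < f p -> f z < f p.
Proof.
move=> pqx pqz xpz; rewrite -!(subr_lt0 (f p)) => qp xp.
rewrite -(pmulr_rlt0 _ pqx).
have -> : orient p q x * (f z - f p) =
    orient x p z * (f q - f p) + orient p q z * (f x - f p).
  by rewrite /f /orient /affine; ring.
by rewrite -(pmulr_rlt0 _ xpz) in qp; rewrite -(pmulr_rlt0 _ pqz) in xp; lra.
Qed.

(* Otherwise the intersection point of the diagonals [p y] and [q x] would lie
   on both sides of the line [affine u v t = 0]. *)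
Lemma no_separated_diagonals u v t p q x y (f := affine u v t) :
  0 < f p -> f q < 0 -> f x < 0 -> 0 < f y ->
  0 < orient p q x -> 0 <= orient p q y ->
  orient p x y <= 0 -> orient q x y <= 0 -> False.
Proof.
move=> p0 q0 x0 y0 pqx pqy pxy qxy.
have := affine_barycentric u v t q x y p; rewrite -/f.
rewrite (orient_rot p x y) (orient_rev p q y) (orient_rot p q x).
have := mulr_le0_ge0 qxy (ltW p0); have := mulr_le0 pxy (ltW q0).
have := mulr_ge0_le0 pqy (ltW x0); have := mulr_gt0 pqx y0.
by lra.
Qed.

End Orientation.

Section Triangle.
Variable R : realType.
Implicit Types a b c p q w z : point R.

Definition in_ccw_tri a b c z :=
  [&& 0 < orient a b z, 0 < orient b c z & 0 < orient c a z].

Lemma in_ccw_tri_gt0 a b c z : in_ccw_tri a b c z -> 0 < orient a b c.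
Proof. by case/and3P=> abz bcz caz; rewrite -(orient_split _ _ _ z); lra. Qed.

Lemma in_open_triE a b c z :
  0 < orient a b c -> in_open_tri a b c z = in_ccw_tri a b c z.
Proof.
move=> abc; rewrite /in_open_tri /in_ccw_tri -andbA.
case: and3P => //= _; apply/negP => /andP[/andP[? ?] ?].
by move: (orient_split a b c z); lra.
Qed.

Lemma in_ccw_tri_orient a b c p q z : in_ccw_tri a b c z ->
  0 <= orient p q a -> 0 <= orient p q b -> 0 <= orient p q c ->
  0 < orient p q a + orient p q b + orient p q c -> 0 < orient p q z.
Proof.
move=> /[dup] /in_ccw_tri_gt0 abc /and3P[abz bcz caz] pqa pqb pqc pq_abc.
rewrite -(pmulr_rgt0 _ abc) !(orient_affine p q) affine_barycentric -!orient_affine.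
have ge0_a := mulr_ge0 (ltW bcz) pqa; have ge0_b := mulr_ge0 (ltW caz) pqb.
have ge0_c := mulr_ge0 (ltW abz) pqc.
have [/(mulr_gt0 bcz)|pqa0] := ltrP 0 (orient p q a); first by lra.
have [/(mulr_gt0 caz)|pqb0] := ltrP 0 (orient p q b); first by lra.
have /(mulr_gt0 abz) : 0 < orient p q c by lra.
by lra.
Qed.

Lemma in_ccw_tri_subl a b c z w :
  in_ccw_tri a b c z -> in_ccw_tri a b z w -> in_ccw_tri a b c w.
Proof.
move=> abcz abzw; have abc := in_ccw_tri_gt0 abcz.
have bca : 0 < orient b c a by rewrite orient_rot.
have cab : 0 < orient c a b by rewrite -orient_rot.
case/and3P: abcz => abz bcz caz; apply/and3P; split.
- by case/and3P: abzw.
- by apply: (in_ccw_tri_orient abzw); rewrite ?orient_id13; lra.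
- by apply: (in_ccw_tri_orient abzw); rewrite ?orient_id23; lra.
Qed.

Lemma in_ccw_tri_rot a b c z : in_ccw_tri b c a z = in_ccw_tri a b c z.
Proof. by rewrite /in_ccw_tri andbA andbC. Qed.

Lemma in_ccw_tri_subr a b c z w :
  in_ccw_tri a b c z -> in_ccw_tri a z c w -> in_ccw_tri a b c w.
Proof. by rewrite !(in_ccw_tri_rot c a); apply: in_ccw_tri_subl. Qed.

End Triangle.

Section Quadrilateral.
Variable R : realType.
Implicit Types a b c d p q x : point R.

Lemma on_segC a b x : on_seg a b x -> on_seg b a x.
Proof.
case=> t [/andP[t0 t1] ->]; exists (1 - t); split; first by apply/andP; lra.
by congr pair; ring.
Qed.

Lemma orient_on_seg p q a b x : on_seg a b x -> exists2 t, 0 <= t <= 1 &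
  x = (a.1 + t * (b.1 - a.1), a.2 + t * (b.2 - a.2)) /\
  orient p q x = (1 - t) * orient p q a + t * orient p q b.
Proof.
by case=> t [t01 ->]; exists t => //; split=> //; rewrite /orient /=; ring.
Qed.

Lemma on_seg_gt0_eql p q a b x :
  0 <= orient p q a -> 0 < orient p q b -> on_seg a b x ->
  orient p q x <= 0 -> x = a.
Proof.
move=> pqa pqb /(orient_on_seg p q)[t /andP[t0 t1] [-> ->]].
have ta : 0 <= (1 - t) * orient p q a by rewrite mulr_ge0 // subr_ge0.
rewrite -oppr_ge0 opprD addrC => tb.
have /eqP : t * orient p q b = 0.
  by apply: le_anti; rewrite (mulr_ge0 t0 (ltW pqb)) andbT; lra.
rewrite mulf_eq0 (gt_eqF pqb) orbF => /eqP->.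
by rewrite !mul0r !addr0; case: (a).
Qed.

Lemma on_seg_orient_ge0 p q a b x :
  0 <= orient p q a -> 0 <= orient p q b -> on_seg a b x -> 0 <= orient p q x.
Proof.
move=> pqa pqb /(orient_on_seg p q)[t /andP[t0 t1] [_ ->]].
by rewrite addr_ge0 // mulr_ge0 // subr_ge0.
Qed.

Lemma segs_opposite_sides p q a b c d x :
  0 <= orient p q a -> 0 < orient p q b ->
  orient p q c <= 0 -> orient p q d < 0 ->
  on_seg a b x -> on_seg c d x -> x = a /\ x = c.
Proof.
move=> pqa pqb pqc pqd abx cdx.
have pqx := on_seg_orient_ge0 pqa (ltW pqb) abx.
have qpc : 0 <= orient q p c by rewrite orient_swapl oppr_ge0.
have qpd : 0 < orient q p d by rewrite orient_swapl oppr_gt0.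
have qpx := on_seg_orient_ge0 qpc (ltW qpd) cdx.
split; first by apply: (on_seg_gt0_eql pqa pqb abx); rewrite -oppr_ge0 -orient_swapl.
by apply: (on_seg_gt0_eql qpc qpd cdx); rewrite -oppr_ge0 -orient_swapl.
Qed.

Lemma segs_share_endpoint a b c x :
  orient a b c != 0 -> on_seg a b x -> on_seg b c x -> x = b.
Proof.
move=> abc /(orient_on_seg b c)[t _ [xE bcx]].
case/(orient_on_seg b c)=> s _ [_ bcx0].
have /eqP : (1 - t) * orient b c a = 0.
  by move: bcx bcx0; rewrite orient_id13 orient_id23; lra.
rewrite mulf_eq0 orient_rot (negPf abc) orbF subr_eq0 => /eqP t1.
by rewrite xE -t1 !mul1r; case: (b) => b1 b2 /=; congr pair; ring.
Qed.

Lemma simple_quad_diag a b c d :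
  0 < orient a b c -> 0 < orient a c d -> simple_quad a b c d.
Proof.
move=> abc acd.
have acb : orient a c b < 0 by rewrite orient_swapr oppr_lt0.
have uniq_abcd : uniq [:: a; b; c; d].
  have /orient_neq0_uniq := lt0r_neq0 abc; have /orient_neq0_uniq := lt0r_neq0 acd.
  have bd : b != d by apply: contraTneq acb => ->; rewrite -leNgt ltW.
  rewrite /= !inE !negb_or !andbT bd => /andP[/andP[-> ->] ->].
  by case/andP=> /andP[-> _] ->.
have [ac bd] : a <> c /\ b <> d.
  move: uniq_abcd; rewrite /= !inE !negb_or !andbT.
  by case/and3P=> /and3P[_ /eqP ? _] /andP[_ /eqP ?] _.
have a0 : orient a c a = 0 by rewrite orient_id13.
have c0 : orient a c c = 0 by rewrite orient_id23.
have cd_ab x : on_seg c d x -> on_seg a b x -> x = c /\ x = a.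
  by apply: (@segs_opposite_sides a c); rewrite ?a0 ?c0.
have cd_cb x : on_seg c d x -> on_seg c b x -> x = c /\ x = c.
  by apply: (@segs_opposite_sides a c); rewrite ?c0.
have ad_ab x : on_seg a d x -> on_seg a b x -> x = a /\ x = a.
  by apply: (@segs_opposite_sides a c); rewrite ?a0.
have ad_cb x : on_seg a d x -> on_seg c b x -> x = a /\ x = c.
  by apply: (@segs_opposite_sides a c); rewrite ?a0 ?c0.
split=> //.
- by case=> x [abx cdx]; have [xc xa] := cd_ab x cdx abx; apply: ac; rewrite -xa.
- case=> x [/on_segC cbx /on_segC adx].
  by have [xa xc] := ad_cb x adx cbx; apply: ac; rewrite -xa.
move=> x; split; [|split; [|split]] => -[].
- by apply: segs_share_endpoint; rewrite gt_eqF.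
- by move=> /on_segC cbx cdx; have [] := cd_cb x cdx cbx.
- by apply: segs_share_endpoint; rewrite orient_rot gt_eqF.
- by move=> /on_segC adx abx; have [] := ad_ab x adx abx.
Qed.

Lemma interior_quad_tri a b c d p : interior_quad a b c d p ->
  in_open_tri a b c p \/ in_open_tri a c d p.
Proof.
case=> _ [_] [_] [_]; rewrite /winding4 /wtri.
by do 2 case: in_open_tri; [left|left|right|].
Qed.

End Quadrilateral.

Section Crossing.
Variables (R : realType) (u v t : R).
Hypothesis normal_neq0 : u != 0 \/ v != 0.
Implicit Types p x y : point R.
Local Notation height := (affine u v t).

(* Abscissa, on the line [height = 0], of its crossing with the line [p x]. *)
Definition crossing p x : R :=
  let abscissa z := u * z.2 - v * z.1 in
  (height p * abscissa x - height x * abscissa p) / (height p - height x).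

Lemma crossingC p x : crossing p x = crossing x p.
Proof. by rewrite /crossing -opprB -[height p - _]opprB invrN mulrNN. Qed.

Lemma crossing_sub p x y :
  height p != height x -> height p != height y ->
  crossing p x - crossing p y = (u ^+ 2 + v ^+ 2)
    / ((height p - height x) * (height p - height y)) * (height p * orient p x y).
Proof.
rewrite -subr_eq0 -[height p == height y]subr_eq0 /crossing /orient /affine => px py.
by field; rewrite px py.
Qed.

Lemma crossing_lt p x y : height p * height x < 0 -> height p * height y < 0 ->
  (crossing p y < crossing p x) = (0 < height p * orient p x y).
Proof.
move=> px py; rewrite -subr_gt0 crossing_sub.
- rewrite pmulr_rgt0 // divr_gt0 //.
    rewrite lt0r paddr_eq0 ?addr_ge0 ?sqr_ge0 // !sqrf_eq0 negb_and andbT.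
    exact/orP.
  by have [p0|p0|p0] := ltrgt0P (height p); move: px py; nra.
- by apply: contraTneq px => <-; rewrite -leNgt -expr2 sqr_ge0.
- by apply: contraTneq py => <-; rewrite -leNgt -expr2 sqr_ge0.
Qed.

End Crossing.

Section Counting.
Local Open Scope nat_scope.
Implicit Types T U : finType.

Lemma leq_card_rel T U (A : {set T}) (B : {set U}) (P : T -> U -> Prop) :
  (forall x, x \in A -> exists2 y, y \in B & P x y) ->
  (forall x x' y, P x y -> P x' y -> x = x') -> #|A| <= #|B|.
Proof.
move=> Pex Pinj; pose f y := [pick x in A | `[< P x y >]].
have SomeI : injective (@Some T) by move=> ? ? [].
rewrite -(card_imset (mem A) SomeI); apply: leq_trans (leq_imset_card f B).
apply/subset_leq_card/subsetP => _ /imsetP[x xA ->].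
have [y yB Pxy] := Pex x xA; apply/imsetP; exists y => //; rewrite /f.
case: pickP => [x' /andP[_ /asboolP Px'y]|/(_ x)]; last by rewrite xA asboolT.
by rewrite (Pinj _ _ _ Pxy Px'y).
Qed.

Lemma markov_card T (F : T -> nat) k :
  k * #|[set x | k <= F x]| <= \sum_x F x.
Proof.
rewrite mulnC -sum_nat_const big_mkcond leq_sum // => x _.
by rewrite inE; case: ifP.
Qed.

Lemma sum_card_asym_leq T (lt : rel T) :
  (forall x y, lt x y -> ~~ lt y x) ->
  2 * (\sum_x #|[set y | lt y x]|) <= #|T| * #|T|.-1.
Proof.
move=> asym; have cardE x : #|[set y | lt y x]| = \sum_y lt y x.
  by rewrite -sum1dep_card big_mkcond; apply: eq_bigr => y _; case: ifP.
rewrite (eq_bigr _ (fun x _ => cardE x)) mul2n -addnn {2}exchange_big -big_split /=.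
rewrite -sum_nat_const leq_sum // => x _; rewrite -big_split /= -(cardC1 x) -sum1_card.
rewrite [leqRHS]big_mkcond leq_sum // => y _; rewrite inE.
have [->|_] := eqVneq y x; last first.
  by have := asym y x; case: (lt y x) (lt x y) => [] [] // /(_ isT).
by have := asym x x; case: (lt x x) => // /(_ isT).
Qed.

Lemma card_crowded_leq T U (D : T -> U -> {set T}) (lt : rel T) :
  (forall x y, lt x y -> ~~ lt y x) ->
  (forall x i y, y \in D x i -> lt y x) ->
  (forall x i j y, y \in D x i -> y \in D x j -> i = j) ->
  4 * #|[set p | 1 < #|D p.1 p.2|]| <= #|T| * #|T|.-1.
Proof.
move=> asym Dlt Ddisj; apply: leq_trans (sum_card_asym_leq asym).
rewrite -[4]/(2 * 2) -mulnA leq_mul2l /=; apply: leq_trans (markov_card _ _) _.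
rewrite -(pair_bigA _ (fun x i => #|D x i|)) leq_sum //= => x _.
under eq_bigr do rewrite -sum1_card.
rewrite -partition_disjoint_bigcup /=; last first.
  move=> i j; apply: contraNT => /pred0Pn[y /andP[yi yj]].
  by apply/eqP; apply: Ddisj yi yj.
rewrite sum1_card; apply/subset_leq_card/bigcupsP => i _.
by apply/subsetP => y /Dlt; rewrite inE.
Qed.

Lemma card_setCU_fst_snd_inj T U (A B : {set T * U}) p :
  {in A &, injective fst} -> {in B &, injective snd} -> p \in A :&: B ->
  #|T| * #|U| < #|~: (A :|: B)| + #|T| + #|U|.
Proof.
move=> Ainj Binj pAB.
have leA : #|A| <= #|T| by rewrite -(card_in_imset Ainj) max_card.
have leB : #|B| <= #|U| by rewrite -(card_in_imset Binj) max_card.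
have AB0 : 0 < #|A :&: B| by apply/card_gt0P; exists p.
by have := cardsC (A :|: B); have := cardsUI A B; rewrite card_prod; lia.
Qed.

End Counting.

Section ColouredPoints.
Variables (R : realType) (n : nat) (pt : cidx n -> point R).
Implicit Types (i j k l : cidx n) (r b : 'I_n) (p : 'I_n * 'I_n).

Local Notation ori i j k := (orient (pt i) (pt j) (pt k)).
Local Notation ccw i j k := (0 < ori i j k).

Definition tri_points i j k : {set cidx n} :=
  [set z | in_ccw_tri (pt i) (pt j) (pt k) (pt z)].

Definition empty_ccw_tri i j k := ccw i j k && (tri_points i j k == set0).

Lemma ccw_neq i j k : ccw i j k -> [/\ i != j, j != k & i != k].
Proof.
move=> /lt0r_neq0 /orient_neq0_uniq /(@map_uniq _ _ pt [:: i; j; k]).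
by rewrite /= !inE negb_or !andbT => /andP[/andP[-> ->] ->].
Qed.

Lemma cover_quad_edges i j k l : cover (quad_edges i j k l) = [set i; j; k; l].
Proof.
apply/setP => z; rewrite /cover /quad_edges !bigcup_setU !big_set1 !inE.
by case: (z == i); case: (z == j); case: (z == k); case: (z == l).
Qed.

Lemma balanced_4hole_diag i j k l :
  empty_ccw_tri i j k -> empty_ccw_tri i k l ->
  count (@is_red n) [:: i; j; k; l] = 2%N ->
  quad_edges i j k l \in balanced_4holes pt.
Proof.
move=> /andP[ijk /eqP ijk0] /andP[ikl /eqP ikl0] two_red; rewrite inE.
apply/existsP; exists (i, j, k, l); rewrite eqxx andbT; apply/asboolP.
have simple := simple_quad_diag ijk ikl; split=> //.
  by case: simple => uniq_pt _ _ _; apply: (@map_uniq _ _ pt [:: i; j; k; l]).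
move=> z /interior_quad_tri[]; rewrite in_open_triE // => tri_z.
  by have /setP/(_ z) := ijk0; rewrite !inE tri_z.
by have /setP/(_ z) := ikl0; rewrite !inE tri_z.
Qed.

Lemma balanced_4hole_reflex i j k s :
  tri_points i j k = [set s] -> count (@is_red n) [:: i; j; s; k] = 2%N ->
  quad_edges i j s k \in balanced_4holes pt.
Proof.
move=> tri_s two_red; have : s \in tri_points i j k by rewrite tri_s set11.
rewrite inE => s_ijk; have /and3P[ijs _ kis] := s_ijk.
have isk : ccw i s k by rewrite orient_rot.
apply: balanced_4hole_diag => //; rewrite /empty_ccw_tri ?ijs ?isk /=.
  apply/eqP/setP => z; rewrite !inE; apply/negP => z_ijs.
  have : z \in tri_points i j k by rewrite inE (in_ccw_tri_subl s_ijk z_ijs).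
  rewrite tri_s inE => /eqP z_s; move: z_ijs.
  by rewrite z_s /in_ccw_tri orient_id23 ltxx /= andbF.
apply/eqP/setP => z; rewrite !inE; apply/negP => z_isk.
have : z \in tri_points i j k by rewrite inE (in_ccw_tri_subr s_ijk z_isk).
rewrite tri_s inE => /eqP z_s; move: z_isk.
by rewrite z_s /in_ccw_tri orient_id23 ltxx.
Qed.

(* The red-blue side of the convex hull of [V] having [V] on its left. *)
Definition left_bitangent p (V : {set cidx n}) :=
  [/\ inl p.1 \in V, inr p.2 \in V &
    {in V, forall z, 0 <= ori (inl p.1) (inr p.2) z}].

Definition has_left_hole p :=
  exists2 E, E \in balanced_4holes pt & left_bitangent p (cover E).

Lemma quad_edges_left_hole r b j k :
  ccw (inl r) (inr b) j -> ccw (inl r) (inr b) k ->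
  quad_edges (inl r) (inr b) j k \in balanced_4holes pt -> has_left_hole (r, b).
Proof.
move=> rbj rbk hole; exists (quad_edges (inl r) (inr b) j k) => //.
rewrite cover_quad_edges; split; rewrite ?inE ?eqxx ?orbT // => z.
rewrite !inE -!orbA => /or4P[] /eqP-> /=; rewrite ?orient_id13 ?orient_id23 //.
  exact: ltW.
exact: ltW.
Qed.

Lemma tri_left_hole_or_empty r b k : ccw (inl r) (inr b) k ->
  (#|tri_points (inl r) (inr b) k| <= 1)%N ->
  {in tri_points (inl r) (inr b) k, forall s, is_red s != is_red k} ->
  has_left_hole (r, b) \/ empty_ccw_tri (inl r) (inr b) k.
Proof.
move=> rbk; rewrite /empty_ccw_tri rbk leq_eqVlt ltnS leqn0 cards_eq0.
case/orP=> [/cards1P[s tri_s] alt|->]; [left | by right].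
have s_tri : s \in tri_points (inl r) (inr b) k by rewrite tri_s set11.
apply: (@quad_edges_left_hole r b s k) => //.
  by move: s_tri; rewrite inE => /andP[].
apply: balanced_4hole_reflex tri_s _.
by move: (alt s s_tri) => /=; case: (is_red s) (is_red k) => [] [].
Qed.

Hypothesis gp : general_position pt.

Lemma orient_pt_neq0 i j k : i != j -> j != k -> i != k -> ori i j k != 0.
Proof. by move=> /eqP ij /eqP jk /eqP ik; apply/eqP; apply: gp. Qed.

Lemma ccwNr i j k : i != j -> j != k -> i != k -> ~~ ccw i j k = ccw i k j.
Proof.
move=> ij jk ik; rewrite -leNgt le_eqVlt (negPf (orient_pt_neq0 ij jk ik)) /=.
by rewrite [ori i k j]orient_swapr oppr_gt0.
Qed.

Lemma ccwNl i j k : i != j -> j != k -> i != k -> ~~ ccw i j k = ccw j i k.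
Proof. by move=> ij jk ik; rewrite ccwNr // (orient_rot (pt j)). Qed.

Lemma ccwN_rev i j k : i != j -> j != k -> i != k -> ~~ ccw i j k = ccw k j i.
Proof. by move=> ij jk ik; rewrite ccwNr // (orient_rot (pt i)). Qed.

(* A point of [i k l] closest to the line [i j] works. *)
Lemma exists_empty_tri i j k l :
  empty_ccw_tri i j k -> ccw i j l -> ccw i k l -> ccw j k l ->
  tri_points i k l != set0 ->
  exists2 z, z \in tri_points i k l & empty_ccw_tri i j z.
Proof.
move=> /andP[ijk /eqP ijk0] ijl ikl jkl /set0Pn[z0 z0_ikl].
have [z z_ikl zmin] :=
  @arg_minP _ _ _ _ (fun z => z \in tri_points i k l) (fun z => ori i j z) z0_ikl.
have := z_ikl; rewrite inE => z_in_ikl.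
have ijz : ccw i j z by apply: (in_ccw_tri_orient z_in_ikl); rewrite ?orient_id13; lra.
exists z => //; rewrite /empty_ccw_tri ijz.
apply/eqP/setP => w; rewrite !inE; apply/negP => w_ijz.
have /and3P[ikz klz liz] := z_in_ikl.
have kli : ccw k l i by rewrite orient_rot.
have klj : ccw k l j by rewrite orient_rot.
have lij : ccw l i j by rewrite -orient_rot.
have jki : ccw j k i by rewrite orient_rot.
have jkz : ccw j k z by apply: (in_ccw_tri_orient z_in_ikl); rewrite ?orient_id23; lra.
have klw : ccw k l w by apply: (in_ccw_tri_orient w_ijz); lra.
have liw : ccw l i w.
  by apply: (in_ccw_tri_orient w_ijz); rewrite ?orient_id23; lra.
have jkw : ccw j k w.
  by apply: (in_ccw_tri_orient w_ijz); rewrite ?orient_id13; lra.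
have /and3P[ijw jzw ziw] := w_ijz.
have ikw : ccw i k w.
  have [[ik _ _] [_ _ kw] [_ _ iw]] := And3 (ccw_neq ikl) (ccw_neq klw) (ccw_neq ijw).
  rewrite -[ccw i k w]negbK ccwNl //; apply/negP => kiw.
  by have /setP/(_ w) := ijk0; rewrite !inE /in_ccw_tri ijw jkw kiw.
have := zmin w; rewrite inE /in_ccw_tri ikw klw liw => /(_ isT).
by have := orient_split (pt i) (pt j) (pt z) (pt w); lra.
Qed.

Hypothesis sep : lin_separable pt.

Lemma exists_crossing : exists cross : 'I_n -> 'I_n -> R,
  (forall r b z, ccw (inl r) (inr b) (inr z) = (cross r z < cross r b)) /\
  (forall r b z, ccw (inl r) (inr b) (inl z) = (cross z b < cross r b)).
Proof.
have [u [v [t [uv0 [red blue]]]]] := sep.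
have f_red r : 0 < affine u v t (pt (inl r)) by apply: red.
have f_blue b : affine u v t (pt (inr b)) < 0 by apply: blue.
exists (fun r b => crossing u v t (pt (inl r)) (pt (inr b))); split=> r b z.
  by rewrite crossing_lt ?pmulr_rlt0 ?pmulr_rgt0.
rewrite ![crossing _ _ _ _ (pt (inr b))]crossingC.
by rewrite crossing_lt ?nmulr_rlt0 ?nmulr_rgt0 // [in RHS]orient_swapl oppr_lt0.
Qed.

Lemma no_alternating_quad r b x y :
  ccw (inl r) (inr b) (inr x) -> 0 <= ori (inl r) (inr b) (inl y) ->
  ori (inl r) (inr x) (inl y) <= 0 -> ori (inr b) (inr x) (inl y) <= 0 -> False.
Proof.
have [u [v [t [_ [red blue]]]]] := sep.
apply: (@no_separated_diagonals _ u v t).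
- exact: red.
- exact: blue.
- exact: blue.
- exact: red.
Qed.

Lemma left_bitangent_inj p q V :
  left_bitangent p V -> left_bitangent q V -> p = q.
Proof.
case: p q => r b [r' b'] [/= Vr Vb leftV] [/= Vr' Vb' leftV'].
have [rr'|rr'] := eqVneq r r'.
  subst r'; congr pair; apply/eqP; apply: contraT => bb'.
  have /eqP[] := @orient_pt_neq0 (inl r) (inr b) (inr b') isT bb' isT.
  by have := leftV _ Vb'; have := leftV' _ Vb; rewrite orient_swapr; lra.
have [bb'|bb'] := eqVneq b b'.
  subst b'; have /eqP[] := @orient_pt_neq0 (inl r) (inr b) (inl r') isT isT rr'.
  by have := leftV _ Vr'; have := leftV' _ Vr; rewrite orient_rev; lra.
exfalso; apply: (@no_alternating_quad r b b' r').
- by rewrite lt0r orient_pt_neq0 //= leftV.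
- exact: leftV.
- by rewrite -oppr_ge0 -orient_rev leftV'.
- by rewrite -oppr_ge0 -orient_rev leftV'.
Qed.

Lemma convex_quad r b x y :
  empty_ccw_tri (inl r) (inr b) (inr x) -> empty_ccw_tri (inl r) (inr b) (inl y) ->
  ccw (inl r) (inr x) (inl y) /\ ccw (inr b) (inr x) (inl y).
Proof.
move=> /andP[rbx /eqP rbx0] /andP[rby /eqP rby0].
have [_ bx _] := ccw_neq rbx; have [_ _ ry] := ccw_neq rby.
have /setP/(_ (inl y)) := rbx0; rewrite !inE /in_ccw_tri rby -(@ccwNl (inl r)) //.
have /setP/(_ (inr x)) := rby0; rewrite !inE /in_ccw_tri rbx -(@ccwNr (inr b)) //.
rewrite -(orient_rot _ (pt (inl r))) /=.
have := @no_alternating_quad r b x y rbx (ltW rby).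
rewrite !leNgt; case: (ccw (inl r) _ _) (ccw (inr b) _ _) => [] [] //= no_alt _ _ //.
by case: no_alt.
Qed.

Lemma convex_left_hole r b x0 y0 :
  empty_ccw_tri (inl r) (inr b) (inr x0) ->
  empty_ccw_tri (inl r) (inr b) (inl y0) -> has_left_hole (r, b).
Proof.
have [cross [blue_left red_left]] := exists_crossing => rbx0 rby0.
have [x rbx xmin] := @arg_minP _ _ _ _
  (fun z => empty_ccw_tri (inl r) (inr b) (inr z)) (cross r) rbx0.
have [y rby ymin] := @arg_minP _ _ _ _
  (fun z => empty_ccw_tri (inl r) (inr b) (inl z)) (cross^~ b) rby0.
have [rxy bxy] := convex_quad rbx rby.
have [[rbx_ccw _] [rby_ccw /eqP rbyE]] := (andP rbx, andP rby).
apply: (@quad_edges_left_hole _ _ (inr x) (inl y)) => //.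
apply: balanced_4hole_diag => //; rewrite /empty_ccw_tri rxy.
apply: contraT => rxy_neq0.
have [[z|z] z_rxy rbz] := exists_empty_tri rbx rby_ccw rxy bxy rxy_neq0.
  have := ymin z rbz; rewrite leNgt -red_left.
  move: z_rxy; rewrite inE => /and3P[_ xyz yrz]; have [_ yz _] := ccw_neq xyz.
  rewrite ccwNl // => byz; have /andP[rbz_ccw _] := rbz.
  by have /setP/(_ (inl z)) := rbyE; rewrite !inE /in_ccw_tri rbz_ccw byz yrz.
have := xmin z rbz; rewrite leNgt -blue_left.
by move: z_rxy; rewrite inE => /andP[->].
Qed.

(* Red points seen from [r] between [b] and the next blue point to its left.
   The cone is empty if there is no such blue point; this keeps its points
   closer to the separating line than [r]. *)
Definition red_cone r b : {set 'I_n} :=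
  [set s | [&& ccw (inl r) (inr b) (inl s),
    [exists z, ccw (inl r) (inr b) (inr z)] &
    [forall z, ccw (inl r) (inr b) (inr z) ==> ccw (inl r) (inl s) (inr z)]]].

Definition crowded_pairs : {set 'I_n * 'I_n} :=
  [set p | (1 < #|red_cone p.1 p.2|)%N].

Lemma exists_next_blue r b : (exists x, ccw (inl r) (inr b) (inr x)) ->
  exists2 x, ccw (inl r) (inr b) (inr x) &
    tri_points (inl r) (inr b) (inr x) \subset inl @: red_cone r b.
Proof.
have [cross [blue_left _]] := exists_crossing; case=> x0 rbx0.
have [x rbx xmax] :=
  @arg_maxP _ _ _ _ (fun z => ccw (inl r) (inr b) (inr z)) (cross r) rbx0.
have rzx z : ccw (inl r) (inr b) (inr z) -> ~~ ccw (inl r) (inr z) (inr x).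
  by move=> /xmax; rewrite blue_left -leNgt.
exists x => //; apply/subsetP => -[s|z]; rewrite inE => tri_rbx.
  apply: imset_f; have /and3P[rbs _ _] := tri_rbx.
  rewrite inE rbs /=; apply/andP; split; first by apply/existsP; exists x.
  apply/forallP => z; apply/implyP => rbz; rewrite -orient_rot -orient_rot.
  have zrb : ccw (inr z) (inl r) (inr b) by rewrite -orient_rot.
  have zrx : 0 <= ori (inr z) (inl r) (inr x).
    by have := rzx z rbz; rewrite -leNgt -oppr_ge0 -orient_swapl.
  by apply: (in_ccw_tri_orient tri_rbx); rewrite ?orient_id23; lra.
by have /and3P[/rzx + _ xrz] := tri_rbx; rewrite orient_rot xrz.
Qed.

Lemma red_cone_disjoint r b b' s :
  s \in red_cone r b -> s \in red_cone r b' -> b = b'.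
Proof.
have not_left c c' : s \in red_cone r c -> s \in red_cone r c' ->
    ~~ ccw (inl r) (inr c) (inr c').
  rewrite !inE => /and3P[_ _ /forallP sc] /and3P[rc's _ _].
  by apply/negP => /(implyP (sc c')); rewrite orient_swapr; lra.
move=> sb sb'; apply/eqP; apply: contraT => bb'.
by have := not_left _ _ sb sb'; rewrite ccwNr // (negPf (not_left _ _ sb' sb)).
Qed.

Lemma card_crowded_pairs_leq : (4 * #|crowded_pairs| <= n * n.-1)%N.
Proof.
have [u [v [t [_ [red blue]]]]] := sep.
pose lower s r := affine u v t (pt (inl s)) < affine u v t (pt (inl r)).
rewrite -[n in leqRHS]card_ord; apply: (@card_crowded_leq _ _ red_cone lower).
- by move=> r s; rewrite /lower -leNgt => /ltW.
- move=> r b s; rewrite inE => /and3P[rbs /existsP[z rbz] /forallP sz].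
  have blue_lower x : affine u v t (pt (inr x)) < affine u v t (pt (inl r)).
    exact: lt_trans (blue (inr x) isT) (red (inl r) isT).
  apply: (@affine_lt_cone _ u v t _ (pt (inr b)) (pt (inr z))) => //.
  by rewrite -orient_rot (implyP (sz z)).
- exact: red_cone_disjoint.
Qed.

Definition no_blue_left : {set 'I_n * 'I_n} :=
  [set p | [forall z, ~~ ccw (inl p.1) (inr p.2) (inr z)]].

Definition no_red_left : {set 'I_n * 'I_n} :=
  [set p | [forall z, ~~ ccw (inl p.1) (inr p.2) (inl z)]].

Lemma no_blue_left_inj : {in no_blue_left &, injective fst}.
Proof.
move=> [r b] [r' b'] + + /= rr'; rewrite -{r'}rr' !inE.
move=> /forallP b_left /forallP b'_left.
congr pair; apply/eqP; apply: contraT => bb'.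
by have := b_left b'; rewrite ccwNr // (negPf (b'_left b)).
Qed.

Lemma no_red_left_inj : {in no_red_left &, injective snd}.
Proof.
move=> [r b] [r' b'] + + /= bb'; rewrite -{b'}bb' !inE.
move=> /forallP r_left /forallP r'_left.
congr pair; apply/eqP; apply: contraT => rr'.
by have := r_left r'; rewrite ccwN_rev // (negPf (r'_left r)).
Qed.

Lemma exists_pair_nothing_left : (0 < n)%N ->
  exists p, p \in no_blue_left :&: no_red_left.
Proof.
have [cross [blue_left red_left]] := exists_crossing => n_gt0.
have i0 := Ordinal n_gt0.
have [p _ pmin] :=
  @arg_minP _ _ _ (i0, i0) xpredT (fun p => cross p.1 p.2) isT.
exists p; rewrite !inE; apply/andP; split; apply/forallP => z.
  by rewrite blue_left -leNgt (pmin (p.1, z)).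
by rewrite red_left -leNgt (pmin (z, p.2)).
Qed.

End ColouredPoints.

Section Duality.
Variables (R : realType) (n : nat).
Implicit Types (pt : cidx n -> point R) (i j k z : cidx n) (r b : 'I_n).

Definition swap_colour i : cidx n :=
  match i with inl r => inr r | inr b => inl b end.

(* Swapping the colours turns the pair [(r, b)] around; the reflection brings
   its left side back to the left. *)
Definition mirror pt i : point R := ((pt (swap_colour i)).2, (pt (swap_colour i)).1).

Lemma swap_colourK : involutive swap_colour.
Proof. by case. Qed.

Lemma orient_mirror pt i j k :
  orient (mirror pt i) (mirror pt j) (mirror pt k) =
  orient (pt (swap_colour j)) (pt (swap_colour i)) (pt (swap_colour k)).
Proof. by rewrite /orient /=; ring. Qed.

Lemma tri_points_mirror pt i j k z :
  (z \in tri_points (mirror pt) i j k) =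
  (swap_colour z \in
     tri_points pt (swap_colour j) (swap_colour i) (swap_colour k)).
Proof. by rewrite !inE /in_ccw_tri !orient_mirror; congr andb; rewrite andbC. Qed.

Lemma general_position_mirror pt :
  general_position pt -> general_position (mirror pt).
Proof.
move=> gp i j k ij jk ik; rewrite /collinear orient_mirror.
by apply: gp => /(can_inj swap_colourK); congruence.
Qed.

Lemma lin_separable_mirror pt : lin_separable pt -> lin_separable (mirror pt).
Proof.
case=> u [v [t [uv0 [red blue]]]]; exists (- v), (- u), (- t).
split; first by rewrite !oppr_eq0; case: uv0; [right|left].
split=> -[z|z] //= _; [have := blue (inr z) isT|have := red (inl z) isT]; lra.
Qed.

Lemma exists_next_red pt r b : lin_separable pt ->
  (exists y, 0 < orient (pt (inl r)) (pt (inr b)) (pt (inl y))) ->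
  exists2 y, 0 < orient (pt (inl r)) (pt (inr b)) (pt (inl y)) &
    tri_points pt (inl r) (inr b) (inl y) \subset
      inr @: red_cone (mirror pt) b r.
Proof.
move=> /lin_separable_mirror sep [y0 rby0].
have [|y] := @exists_next_blue _ _ _ sep b r; first by exists y0; rewrite orient_mirror.
rewrite orient_mirror => rby /subsetP tri_cone; exists y => //.
apply/subsetP => z z_tri.
have /imsetP[s sb zE] : swap_colour z \in inl @: red_cone (mirror pt) b r.
  by apply: tri_cone; rewrite tri_points_mirror swap_colourK.
by apply/imsetP; exists s => //; rewrite -[z]swap_colourK zE.
Qed.

End Duality.

Section Count.
Variables (R : realType) (n : nat) (pt : cidx n -> point R).
Hypotheses (gp : general_position pt) (sep : lin_separable pt).
Local Notation ccw i j k := (0 < orient (pt i) (pt j) (pt k)).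
Implicit Types (r b : 'I_n) (p : 'I_n * 'I_n).

Definition blue_crowded_pairs : {set 'I_n * 'I_n} :=
  [set (p.2, p.1) | p in crowded_pairs (mirror pt)].

Lemma card_blue_crowded_pairs_leq : (4 * #|blue_crowded_pairs| <= n * n.-1)%N.
Proof.
have gp_mirror := general_position_mirror gp.
have sep_mirror := lin_separable_mirror sep.
apply: leq_trans (card_crowded_pairs_leq gp_mirror sep_mirror).
by rewrite leq_mul2l leq_imset_card.
Qed.

Definition good_pairs : {set 'I_n * 'I_n} := ~: (no_blue_left pt :|: no_red_left pt).

Lemma uncrowded_left_hole r b :
  (r, b) \in good_pairs ->
  (r, b) \notin crowded_pairs pt -> (r, b) \notin blue_crowded_pairs ->
  has_left_hole pt (r, b).
Proof.
rewrite !inE negb_or -leqNgt /= => /andP[/forallPn[x0 /negPn rbx0]].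
move=> /forallPn[y0 /negPn rby0] red_le1 not_crowded.
have blue_le1 : (#|red_cone (mirror pt) b r| <= 1)%N.
  rewrite leqNgt; apply: contra not_crowded => many.
  by apply/imsetP; exists (b, r); rewrite ?inE.
have [|x rbx x_cone] := @exists_next_blue _ _ _ sep r b; first by exists x0.
have [|y rby y_cone] := @exists_next_red _ _ _ r b sep; first by exists y0.
have card_x := leq_trans (subset_leq_card x_cone) (leq_imset_card _ _).
have card_y := leq_trans (subset_leq_card y_cone) (leq_imset_card _ _).
have [||//|rbx_empty] := @tri_left_hole_or_empty _ _ pt r b (inr x) rbx.
- exact: leq_trans card_x red_le1.
- by move=> z /(subsetP x_cone)/imsetP[s _ ->].
have [||//|rby_empty] := @tri_left_hole_or_empty _ _ pt r b (inl y) rby.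
- exact: leq_trans card_y blue_le1.
- by move=> z /(subsetP y_cone)/imsetP[s _ ->].
exact: convex_left_hole rbx_empty rby_empty.
Qed.

Lemma card_good_pairs_gt : (0 < n)%N -> (n * n < #|good_pairs| + n + n)%N.
Proof.
move=> /(exists_pair_nothing_left sep)[p].
move/(card_setCU_fst_snd_inj (no_blue_left_inj gp) (no_red_left_inj gp)).
by rewrite !card_ord.
Qed.

Lemma card_good_pairs_leq :
  (#|good_pairs| <=
     #|crowded_pairs pt| + #|blue_crowded_pairs| + #|balanced_4holes pt|)%N.
Proof.
set crowded := crowded_pairs pt :|: blue_crowded_pairs.
have le_holes : (#|good_pairs :\: crowded| <= #|balanced_4holes pt|)%N.
  apply: (@leq_card_rel _ _ _ _ (fun p E => left_bitangent pt p (cover E))).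
    move=> [r b]; rewrite in_setD in_setU negb_or => /andP[/andP[red1 blue1] good].
    exact: uncrowded_left_hole.
  by move=> p q E; apply: left_bitangent_inj.
rewrite -(cardsID crowded) leq_add // -cardsUI.
by apply: leq_trans (leq_addr _ _); rewrite subset_leq_card ?subsetIr.
Qed.

(* The bounds [4 m <= n (n - 1)] are used in the rounded-down form
   [m <= floor (n (n - 1) / 4)]: without rounding they do not suffice for
   [n = 2] and [n = 3]. *)
Lemma card_balanced_4holes_ge :
  (2 * n ^ 2 + 3 * n <= 12 * #|balanced_4holes pt| + 8)%N.
Proof.
have := card_good_pairs_gt; have := card_good_pairs_leq.
have := card_crowded_pairs_leq gp sep; have := card_blue_crowded_pairs_leq.
move: #|good_pairs| #|crowded_pairs pt| #|blue_crowded_pairs| => good red blue.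
case: (n) #|balanced_4holes pt| => [|[|[|[|m]]]] holes; rewrite ?expnS ?expn0 /=; lia.
Qed.

End Count.

Theorem theorem2 (R : realType) (n : nat) (pt : cidx n -> point R) :
  injective pt ->
  general_position pt ->
  lin_separable pt ->
  ((2 * (n%:Z) ^+ 2 + 3 * n%:Z - 8)%:~R / 12 : R) <= (#|balanced_4holes pt|)%:R.
Proof.
move=> _ gp sep; have := card_balanced_4holes_ge gp sep.
rewrite ler_pdivrMr // -(ler_nat R) -mulnn !natrD !natrM.
rewrite rmorphB rmorphD !rmorphM /= -!pmulrn.
by lra.
Qed.
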